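(* Fix $\epsilon>0$, $T>0$ and $x\in\mathbb R^d$. Let $f_1\in C_b^1(\mathbb R^d)$ and $f_2\in C_b^{0,1}([0,T]\times\mathbb R^d)$. Suppose that for $\mu_0$-almost every $\omega\in C([0,T];\mathbb R^d)$ with $\omega(0)=0$, $$f_1(x+\sqrt\epsilon\,\omega(T))=\int_0^Tf_2(s,x+\sqrt\epsilon\,\omega(s))\,ds.$$ Then there is a function $F\in C^1([0,T])$ such that $$f_2(t,y)=F'(t),\qquad f_1(y)=F(T),\qquad\text{for all }(t,y)\in[0,T]\times\mathbb R^d.$$
   Context: $\mu_0$ is Wiener measure on the space of continuous paths $[0,T]\to\mathbb R^d$ starting at $0$ (the law of standard $d$-dimensional Brownian motion). $C_b^1(\mathbb R^d)$: bounded $C^1$ functions with bounded first derivatives. $C_b^{0,1}([0,T]\times\mathbb R^d)$: bounded continuous functions whose first-order derivatives in $x$ are bounded and continuous on $[0,T]\times\mathbb R^d$. *)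

(* Defs.v *)
From HB Require Import structures.
From mathcomp Require Import all_boot all_order all_algebra.
From mathcomp Require Import all_classical all_reals all_analysis.

Set Implicit Arguments.
Unset Strict Implicit.
Unset Printing Implicit Defensive.

Import Order.TTheory GRing.Theory Num.Theory.
Import numFieldNormedType.Exports.

Local Open Scope classical_set_scope.
Local Open Scope ring_scope.

(* C_b^1(R^d); C^1 is expressed by continuous first-order partial
   derivatives. *)
Definition Cb1 (R : realType) (d : nat) (f : 'rV[R]_d -> R) : Prop :=
  [/\ continuous f,
      exists M : R, forall y : 'rV[R]_d, `|f y| <= M &
      forall j : 'I_d,
        [/\ forall y : 'rV[R]_d, derivable f y (delta_mx 0 j),
            continuous (fun y => 'D_(delta_mx 0 j) f y) &
            exists M : R, forall y : 'rV[R]_d, `|'D_(delta_mx 0 j) f y| <= M]].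

(* C_b^{0,1}([0, T] x R^d), for f t y with t the time and y the space variable;
   values of f at times outside [0, T] play no role. *)
Definition Cb01 (R : realType) (T : R) (d : nat)
    (f : R -> 'rV[R]_d -> R) : Prop :=
  [/\ {within `[0, T] `*` [set: 'rV[R]_d],
         continuous (fun p : R * 'rV[R]_d => f p.1 p.2)},
      exists M : R, forall (t : R) (y : 'rV[R]_d), t \in `[0, T] -> `|f t y| <= M &
      forall j : 'I_d,
        [/\ forall (t : R) (y : 'rV[R]_d), t \in `[0, T] -> derivable (f t) y (delta_mx 0 j),
            {within `[0, T] `*` [set: 'rV[R]_d],
               continuous (fun p : R * 'rV[R]_d => 'D_(delta_mx 0 j) (f p.1) p.2)} &
            exists M : R, forall (t : R) (y : 'rV[R]_d), t \in `[0, T] ->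
              `|'D_(delta_mx 0 j) (f t) y| <= M]].

(* Derivative relative to A: on A = [0, T] it is the two-sided derivative at
   interior points and the one-sided derivative at the endpoints. *)
Definition derive_in (R : realType) (A : set R) (F : R -> R) (t : R) : R :=
  lim ((F s - F t) / (s - t) @[s --> within A t^']).

Definition derivable_in (R : realType) (A : set R) (F : R -> R) (t : R) : Prop :=
  cvg ((F s - F t) / (s - t) @[s --> within A t^']).

Definition C1_in (R : realType) (A : set R) (F : R -> R) : Prop :=
  (forall t, A t -> derivable_in A F t) /\
  {within A, continuous (derive_in A F)}.

(* A continuous path [0, T] -> R^d starting at 0 is represented by its unique
   extension to R by 0 outside [0, T]. *)
Record path0 (R : realType) (T : R) (d : nat) := Path0 {
  path0_fun :> R -> 'rV[R]_d ;
  path0_continuous : {within `[0, T], continuous path0_fun} ;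
  path0_start : path0_fun 0 = 0 ;
  path0_outside : forall t, t \notin `[0, T] -> path0_fun t = 0 }.

Section path0_instances.
Context (R : realType) (T : R) (d : nat).

Lemma zero_path_continuous :
  {within `[0, T], continuous (fun _ : R => 0 : 'rV[R]_d)}.
Proof. by apply: continuous_subspaceT => ?; exact: cst_continuous. Qed.

Definition zero_path : path0 T d :=
  @Path0 R T d (fun=> 0) zero_path_continuous erefl (fun _ _ => erefl).

HB.instance Definition _ := gen_eqMixin (path0 T d).
HB.instance Definition _ := gen_choiceMixin (path0 T d).
HB.instance Definition _ := isPointed.Build (path0 T d) zero_path.

End path0_instances.

(* The sigma-algebra on paths generated by the coordinates of the evaluations
   w |-> w t, t in [0, T]; it is the Borel sigma-algebra of the sup norm. *)
Definition path_cylinder (R : realType) (T : R) (d : nat) :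
    set (set (path0 T d)) :=
  [set C | exists (t : R) (j : 'I_d) (B : set R),
     [/\ t \in `[0, T], measurable B & C = [set w : path0 T d | B (w t 0 j)]]].

Definition path_space (R : realType) (T : R) (d : nat) :=
  g_sigma_algebraType (@path_cylinder R T d).

Definition mutually_independent (R : realType) (disp : measure_display)
    (Omega : measurableType disp) (P : probability Omega R)
    (I : finType) (X : I -> Omega -> R) : Prop :=
  forall (J : {set I}) (B : I -> set R), (forall i, measurable (B i)) ->
    P [set w | forall i, i \in J -> B i (X i w)] =
    (\prod_(i in J) P (X i @^-1` B i))%E.

Definition increment (R : realType) (T : R) (d : nat) (s t : R) (j : 'I_d)
    (w : path_space T d) : R :=
  (w : path0 T d) t 0 j - (w : path0 T d) s 0 j.

(* P is the law of standard d-dimensional Brownian motion on [0, T]. The first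
   clause and the independence over j give w t - w s ~ N(0, (t - s) I_d); the
   independence over i is that of the increments over [t i, t i.+1]. The second
   argument of normal_prob is the standard deviation.
   These conditions determine P. *)
Definition is_wiener_measure (R : realType) (T : R) (d : nat)
    (P : probability (path_space T d) R) : Prop :=
  (forall (s t : R) (j : 'I_d), 0 <= s -> s < t -> t <= T ->
     forall B : set R, measurable B ->
       P (increment s t j @^-1` B) = normal_prob 0 (Num.sqrt (t - s)) B) /\
  (forall (n : nat) (t : nat -> R),
     0 <= t 0%N -> (forall i, (i < n)%N -> t i < t i.+1) -> t n <= T ->
     mutually_independent P
       (fun ij : 'I_n * 'I_d => increment (t ij.1) (t ij.1.+1) ij.2)).

(* Main.v *)
(* For 0 < a < b < T, the hypothesis says that almost surely
     f1(x + e w(T)) - int_[0,a] f2(s, x + e w(s)) ds - int_[b,T] f2(s, x + e w(s)) ds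
   is the integral of f2 over [a, b], hence at most M (b - a) in absolute value
   (e is the square root of eps). The left-hand side ignores w on ]a, b[, so one
   coordinate xi of the increment w(b) - w(a) may be replaced by an independent
   Gaussian variable z without changing its law, which shifts w by (z - xi) e_j
   on [b, T]. As Gaussian variables have full support, almost surely the bound
   holds for the shift of w by r e_j on [b, T], for all r. Letting a tend to b,
   f1(x + e w(T)) - int_[b,T] f2(s, x + e w(s)) ds is invariant under these shifts,
   and differentiating in b shows that f2(b, .) is constant.
   Laws are compared on finitely many increments only, by approximating the
   integrals with Riemann sums. *)
Require Import Defs.
From HB Require Import structures.
From mathcomp Require Import all_boot all_order all_algebra.
From mathcomp Require Import all_classical all_reals all_analysis.
From mathcomp Require Import measurable_realfun ring lra.

Set Implicit Arguments.
Unset Strict Implicit.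
Unset Printing Implicit Defensive.

Import Order.TTheory GRing.Theory Num.Theory.
Import numFieldNormedType.Exports.

Local Open Scope classical_set_scope.
Local Open Scope ring_scope.

(** * Almost sure bounds for limits of equally distributed variables, and measurability of random
    vectors *)

(** The bound is encoded as the vanishing of the integral of [psi], a continuous function with
    values in [0, 1] that is zero exactly where [|t| <= c]. Such integrals depend only on laws, and
    dominated convergence carries them to the limits [u] and [v]. *)
Lemma limit_law_ae_le (R : realType) d1 d2
    (T1 : measurableType d1) (T2 : measurableType d2)
    (P1 : {measure set T1 -> \bar R}) (P2 : {measure set T2 -> \bar R})
    (U : nat -> T1 -> R) (u : T1 -> R) (V : nat -> T2 -> R) (v : T2 -> R) (c : R) :
  (P1 setT < +oo)%E -> (P2 setT < +oo)%E ->
  (forall n, measurable_fun setT (U n)) ->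
  (forall n, measurable_fun setT (V n)) ->
  (forall n (A : set R), measurable A -> P1 (U n @^-1` A) = P2 (V n @^-1` A)) ->
  (forall w, U n w @[n --> \oo] --> u w) ->
  (forall w, V n w @[n --> \oo] --> v w) ->
  {ae P1, forall w, `|u w| <= c} -> {ae P2, forall w, `|v w| <= c}.
Proof.
move=> P1oo P2oo mU mV UV Uu Vv uc.
pose psi (t : R) := Num.min 1 (Num.max 0 (`|t| - c)).
have psi_ge0 t : 0 <= psi t by rewrite /psi le_min ler01 le_max lexx.
have psi_le1 t : psi t <= 1 by rewrite /psi ge_min lexx.
have cpsi : continuous psi.
  move=> t; apply: (@continuous_min _ _ (cst 1) (fun t : R => Num.max 0 (`|t| - c))).
    exact: cvg_cst.
  apply: (@continuous_max _ _ (cst 0) (fun t : R => `|t| - c)); first exact: cvg_cst.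
  by apply: cvgB; [exact: norm_continuous|exact: cvg_cst].
have mpsi : measurable_fun setT psi by exact: continuous_measurable_fun.
have psi0 t : (psi t = 0) <-> (`|t| <= c).
  split=> [|tc]; last first.
    by rewrite /psi max_l ?subr_le0// min_r.
  move=> h; rewrite leNgt; apply/negP => tc; suff : 0 < psi t by rewrite h ltxx.
  by rewrite /psi lt_min ltr01 lt_max subr_gt0 tc orbT.
have lim d (T : measurableType d) (P : {measure set T -> \bar R}) (W : nat -> T -> R) w :
    (P setT < +oo)%E ->
    (forall n, measurable_fun setT (W n)) ->
    (forall x, W n x @[n --> \oo] --> w x) ->
    (\int[P]_x (psi (W n x))%:E @[n --> \oo] --> \int[P]_x (psi (w x))%:E)%E.
  move=> Poo mW Ww; apply: (@dominated_cvg _ _ _ _ _ measurableT _ _ (cst 1%E)) => //.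
  - by move=> n; apply/measurable_EFinP; exact: measurableT_comp.
  - move=> x _; apply: cvg_EFin; first by near=> n.
    by apply: continuous_cvg; [exact: cpsi|exact: Ww].
  - apply/integrableP; split => //; under eq_integral do rewrite /= normr1.
    by rewrite integral_cst// mul1e.
  - by move=> n x _ /=; rewrite lee_fin ger0_norm.
have mu : measurable_fun setT u by apply: measurable_fun_cvg mU (fun x _ => Uu x).
have mv : measurable_fun setT v by apply: measurable_fun_cvg mV (fun x _ => Vv x).
have intUV n : (\int[P1]_x (psi (U n x))%:E = \int[P2]_x (psi (V n x))%:E)%E.
  transitivity (\int[pushforward P1 (U n)]_x (psi x)%:E)%E.
    rewrite (ge0_integral_pushforward (mU n))//; last by move=> ? _; rewrite lee_fin.
    exact/measurable_EFinP.
  transitivity (\int[pushforward P2 (V n)]_x (psi x)%:E)%E.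
    by apply: eq_measure_integral => A mA _; exact: UV.
  rewrite (ge0_integral_pushforward (mV n))//; last by move=> ? _; rewrite lee_fin.
  exact/measurable_EFinP.
have iu : (\int[P1]_x (psi (u x))%:E = 0)%E.
  rewrite (ae_eq_integral (cst 0%E)) ?integral0//.
    by apply/measurable_EFinP; exact: measurableT_comp.
  by apply: filterS uc => x /psi0 /= ->.
have iv : (\int[P2]_x (psi (v x))%:E = 0)%E.
  rewrite -iu; have limV := lim _ _ _ _ _ P2oo mV Vv.
  have -> : (\int[P1]_x (psi (u x))%:E =
      limn (fun n => \int[P2]_x (psi (V n x))%:E))%E.
    apply/esym/cvg_lim => //; rewrite -(funext intUV).
    exact: lim _ _ _ _ _ P1oo mU Uu.
  by apply/esym/cvg_lim.
have : (\int[P2]_x `|(psi (v x))%:E| = 0)%E.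
  by rewrite -[RHS]iv; apply: eq_integral => x _; rewrite gee0_abs// lee_fin.
have mpv : measurable_fun setT (fun x => (psi (v x))%:E).
  by apply/measurable_EFinP; exact: measurableT_comp.
move/(ae_eq_integral_abs P2 measurableT mpv).
by apply: filterS => x /(_ I) [/psi0].
Unshelve. all: by end_near. Qed.

Lemma measurable_floor_comp (R : realType) d (T : measurableType d) (Y : T -> R) (c : R) (k : int) :
  measurable_fun setT Y -> measurable [set w | Num.floor (Y w * c) = k].
Proof.
move=> mY.
have -> : [set w | Num.floor (Y w * c) = k] =
    (fun w => Y w * c) @^-1` `[k%:~R, (k + 1)%:~R[.
  apply/seteqP; split => w /=; rewrite in_itv/=.
    by move=> <-; rewrite Num.Theory.floor_le Num.Theory.floorD1_gt.
  exact: Num.Theory.floor_def.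
rewrite -[X in measurable X]setTI; apply: measurable_funM => //.
Qed.

Lemma cvg_rV (R : realType) (n : nat) (I : Type) (F : set_system I) (FF : Filter F)
    (f : I -> 'rV[R]_n) (a : 'rV[R]_n) :
  (forall j, f x 0 j @[x --> F] --> a 0 j) -> f x @[x --> F] --> a.
Proof.
move=> fa A [P aP PA]; rewrite /nbhs /=.
have : F (fun x => forall j : 'I_n, P 0 j (f x 0 j)).
  by apply: filter_forall => j; exact: fa.
by apply: filterS => x Px; apply: PA => i j; rewrite !ord1.
Qed.

(** Rounding the coordinates down to multiples of 1/(m+1) gives a vector with countably many values,
    so [f] of it is measurable whatever [f] is. By continuity of [f], these functions converge
    pointwise to [f \o Y]. *)
Lemma measurable_continuous_rV (R : realType) d (T : measurableType d) (n : nat)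
    (Y : T -> 'rV[R]_n) (f : 'rV[R]_n -> R) :
  (forall j, measurable_fun setT (fun w => Y w 0 j)) ->
  continuous f -> measurable_fun setT (f \o Y).
Proof.
move=> mY cf.
pose k (m : nat) (w : T) : 'rV[int]_n := \row_j Num.floor (Y w 0 j * m.+1%:R).
pose g (m : nat) (z : 'rV[int]_n) : R := f (\row_j ((z 0 j)%:~R / m.+1%:R)).
apply: (@measurable_fun_cvg _ _ _ _ (fun m => g m \o k m)) => [m|w _].
  move=> _ B mB; rewrite setTI.
  have -> : (g m \o k m) @^-1` B =
      \bigcup_(z in [set z | B (g m z)]) \bigcap_(j in [set: 'I_n])
        [set w | Num.floor (Y w 0 j * m.+1%:R) = z 0 j].
    apply/seteqP; split => w /=.
      by move=> Bw; exists (k m w) => // j _ /=; rewrite mxE.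
    move=> [z Bz kz] /=; suff -> : k m w = z by [].
    by apply/rowP => j; rewrite mxE; exact: kz.
  rewrite bigcup_mkcond; apply: countable_bigcupT_measurable => // z.
  case: ifPn => // _; apply: fin_bigcap_measurable => // j _.
  exact: measurable_floor_comp.
have cY : \row_j ((Num.floor (Y w 0 j * m.+1%:R))%:~R / m.+1%:R) @[m --> \oo] --> Y w.
  apply: cvg_rV => j; under eq_fun do rewrite mxE.
  apply/cvgrPdist_le => e e0; near=> m.
  have c0 : 0 < m.+1%:R :> R by [].
  rewrite -[X in `|X - _|](mulfK (lt0r_neq0 c0)) -mulrBl normrM normfV.
  rewrite (ger0_norm (ltW c0)) ler_pdivrMr//.
  have ef : 1 <= e * m.+1%:R.
    rewrite -ler_pdivrMr// div1r; near: m.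
    by apply: filterS (near_infty_natSinv_lt (PosNum e0)) => i /ltW.
  rewrite (le_trans _ ef)//.
  have := floor_le (Y w 0 j * m.+1%:R); have := floorD1_gt (Y w 0 j * m.+1%:R).
  by rewrite intrD => ? ?; rewrite ler_norml; apply/andP; split; lra.
have gk m : (g m \o k m) w =
    f (\row_j ((Num.floor (Y w 0 j * m.+1%:R))%:~R / m.+1%:R)).
  by congr f; apply/rowP => j; rewrite !mxE.
by rewrite (funext gk); apply: continuous_cvg => //; exact: cf.
Unshelve. all: by end_near. Qed.

(** * Laws of finite families of real random variables, and resampling of one member *)

Section boxes.
Context (R : realType) (I : finType).

Definition boxes : set (set (I -> R)) :=
  [set C | exists B : I -> set R,
    (forall i, measurable (B i)) /\ C = [set x | forall i, B i (x i)]].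

(** This is the product Borel sigma-algebra; its generators are stable under intersection, so that
    finite measures need only be compared on boxes. *)
Definition box_space := g_sigma_algebraType boxes.

Lemma box_space_coord (i : I) : measurable_fun setT (fun x : box_space => x i).
Proof.
move=> _ B mB; rewrite setTI; apply: sub_sigma_algebra.
exists (fun k => if k == i then B else setT); split => [k|]; first by case: ifP.
apply/seteqP; split => x /= xB => [k|]; first by case: eqP => // ->.
by have := xB i; rewrite eqxx.
Qed.

Lemma measurable_into_boxes d (T : measurableType d) (X : T -> I -> R) :
  (forall i, measurable_fun setT (X ^~ i)) ->
  measurable_fun setT (X : T -> box_space).
Proof.
move=> mX; apply: (@measurability _ _ T box_space setT X boxes) => //.
move=> _ [C [B [mB ->]] <-]; rewrite setTI.
have -> : X @^-1` [set x | forall i, B i (x i)] =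
    \bigcap_(i in [set: I]) (X ^~ i @^-1` B i).
  by apply/seteqP; split=> w /= h i //=; exact: h.
apply: fin_bigcap_measurable => // i _.
by rewrite -[X in measurable X]setTI; exact: mX.
Qed.

Lemma box_space_measure_unique (m1 m2 : {measure set box_space -> \bar R}) :
  (m1 setT < +oo)%E -> (forall C, boxes C -> m1 C = m2 C) ->
  forall A, measurable A -> m1 A = m2 A.
Proof.
move=> m1fin m12 A mA; apply: (@measure_unique _ R box_space boxes
  (fun=> setT) _ _ _ _ m1 m2) => //.
- move=> _ _ [B [mB ->]] [B' [mB' ->]]; exists (fun i => B i `&` B' i); split.
    by move=> i; exact: measurableI.
  apply/seteqP; split => x /= => [[h h'] i|h]; first by split.
  by split => i; have [] := h i.
- move=> _; exists (fun=> setT); split => //.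
  by apply/seteqP; split.
- by rewrite bigcup_const//; exists 0%N.
Qed.

Definition resample (i0 : I) (x : I -> R) (z : R) : I -> R :=
  fun i => if i == i0 then z else x i.

(** It is enough to treat a box. There both sides are [N (B i0)] times the probability of the
    constraints on the other coordinates: on the left by independence, used for all indices and for
    [[set~ i0]], on the right because the preimage is a rectangle. *)
Lemma resample_law d (T : measurableType d) (P : probability T R)
    (N : probability (measurableTypeR R) R) (X : I -> T -> R) (i0 : I) (A : set box_space) :
  (forall i, measurable_fun setT (X i)) ->
  mutually_independent P X ->
  (forall B, measurable B -> P (X i0 @^-1` B) = N B) ->
  measurable A ->
  P ((fun w i => X i w) @^-1` A) =
  (P \x N)%E ((fun p : T * measurableTypeR R => resample i0 (fun i => X i p.1) p.2) @^-1` A).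
Proof.
move=> mX indX lawX mA.
pose Y w : box_space := fun i => X i w.
pose Z (p : T * measurableTypeR R) : box_space := resample i0 (fun i => X i p.1) p.2.
have mY : measurable_fun setT Y by exact: measurable_into_boxes.
have mZ : measurable_fun setT Z.
  apply: measurable_into_boxes => i; rewrite /Z /resample.
  case: eqP => _; first exact: measurable_snd.
  by apply: measurableT_comp => //.
pose mY_ : {mfun T >-> box_space} :=
  HB.pack Y (isMeasurableFun.Build _ _ _ _ _ mY).
pose mZ_ : {mfun (T * measurableTypeR R)%type >-> box_space} :=
  HB.pack Z (isMeasurableFun.Build _ _ _ _ _ mZ).
apply: (box_space_measure_unique (m1 := pushforward P mY_)
  (m2 := pushforward (P \x N)%E mZ_)) => //.
  by change (P setT < +oo)%E; rewrite probability_setT ltry.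
move=> _ [B [mB ->]].
change (P [set w | forall i, B i (X i w)] =
  (P \x N)%E [set p | forall i, B i (Z p i)]).
have -> : [set w | forall i, B i (X i w)] =
    [set w | forall i, i \in [set: I]%SET -> B i (X i w)].
  by apply/seteqP; split => w /= h i; [move=> _|]; apply: h; rewrite ?inE.
have -> : [set p | forall i, B i (Z p i)] =
    [set w | forall i, i \in [set~ i0]%SET -> B i (X i w)] `*` B i0.
  apply/seteqP; split => -[w z] /=; rewrite /Z /resample /= => h.
    split => [i|]; last by have := h i0; rewrite eqxx.
    by rewrite !inE => /negbTE ii0; have := h i; rewrite ii0.
  by move=> i; case: eqP => [->|/eqP ii0]; [exact: h.2|apply: h.1; rewrite !inE].
have mC : measurable [set w | forall i, i \in [set~ i0]%SET -> B i (X i w)].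
  rewrite (_ : [set w | _] =
      \bigcap_(i in [set i | i \in [set~ i0]%SET]) (X i @^-1` B i)).
    apply: fin_bigcap_measurable => // i _.
    by rewrite -[X in measurable X]setTI; exact: mX.
  by apply/seteqP; split => w.
rewrite (product_measure1E P N mC (mB i0)).
rewrite !indX// (bigD1 i0) ?inE//= lawX// muleC; congr (_ * _)%E.
by rewrite indX//; apply: eq_bigl => i; rewrite !inE.
Qed.

End boxes.

(** * Continuity of pairs, and full support of Gaussian measures *)

Lemma continuous_pair (T U V : topologicalType) (f : T -> U) (g : T -> V) :
  continuous f -> continuous g -> continuous (fun x => (f x, g x)).
Proof. by move=> cf cg x; apply: (cvg_pair (cf x) (cg x)). Qed.

(** The density is strictly positive, so an open set of Gaussian measure zero would be Lebesgue
    null, although it contains an interval around [z]. *)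
Lemma normal_prob_open_gt0 (R : realType) (s : R) (O : set R) (z : R) :
  0 < s -> open O -> O z -> (0 < normal_prob 0 s O)%E.
Proof.
move=> s0 oO Oz.
have mO : measurable O by exact: open_measurable.
rewrite lt0e measure_ge0 andbT; apply/negP => /eqP NO.
have mf : measurable_fun O (fun x => (normal_pdf 0 s x)%:E).
  by apply/measurable_EFinP; apply: measurable_funTS; exact: measurable_normal_pdf.
have : (\int[lebesgue_measure]_(x in O) `|(normal_pdf 0 s x)%:E| = 0)%E.
  rewrite -[RHS]NO; apply: eq_integral => x _.
  by rewrite gee0_abs// lee_fin normal_pdf_ge0.
move=> /(ae_eq_integral_abs (@lebesgue_measure R) mO mf) [A [mA A0 sA]].
have OA : O `<=` A.
  move=> y Oy; apply: sA => /= /(_ Oy) [].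
  apply/eqP; rewrite gt_eqF// normal_pdfE ?gt_eqF//.
  by rewrite mulr_gt0 ?normal_peak_gt0 ?expR_gt0// gt_eqF.
have [e /= e0 zeO] : nbhs z O by exact: open_nbhs_nbhs.
suff : (lebesgue_measure `](z - e)%R, (z + e)%R[%classic <= lebesgue_measure A)%E.
  rewrite A0 lebesgue_measure_itv/= lte_fin ltrD2l gt0_cp//.
  by rewrite -EFinD lee_fin; lra.
rewrite le_measure ?inE// => y /=; rewrite in_itv/= => yze.
by apply: OA; apply: zeO => /=; rewrite distrC ltr_distl.
Qed.

(** * Integrals of continuous functions over segments: Riemann sums, parameters, differentiation at
    an endpoint *)

Section continuous_integral.
Context {R : realType}.
Notation mu := (@lebesgue_measure R).
Implicit Types (g : R -> R) (a b c : R).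

Lemma continuous_itv_integrable g a b :
  continuous g -> mu.-integrable `[a, b] (EFin \o g).
Proof.
move=> cg; apply: continuous_compact_integrable; first exact: segment_compact.
exact: continuous_subspaceT.
Qed.

Lemma Rintegral_itv_cat g a b c : continuous g -> a <= b -> b <= c ->
  \int[mu]_(t in `[a, c]) g t = \int[mu]_(t in `[a, b]) g t + \int[mu]_(t in `[b, c]) g t.
Proof.
move=> cg ab bc; apply/eqP; rewrite addrC -subr_eq; apply/eqP.
rewrite Rintegral_itvB ?bnd_simp//; last exact: continuous_itv_integrable.
rewrite Rintegral_itv_obnd_cbnd//.
apply: integrableS (continuous_itv_integrable b c cg) => //.
by apply: subset_itvr; rewrite bnd_simp.
Qed.

Lemma Rintegral_itv_cst (r a b : R) : a <= b -> \int[mu]_(t in `[a, b]) r = r * (b - a).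
Proof.
move=> ab; rewrite Rintegral_cst//= lebesgue_measure_itv/= lte_fin.
by move: ab; rewrite le_eqVlt => /predU1P[->|->]; rewrite ?ltxx/= ?subrr// ?mulr0.
Qed.

Lemma Rintegral_itv_bound g a b M : continuous g -> a <= b ->
  (forall t, t \in `[a, b] -> `|g t| <= M) ->
  `|\int[mu]_(t in `[a, b]) g t| <= M * (b - a).
Proof.
move=> cg ab gM; have ig := continuous_itv_integrable a b cg.
rewrite (le_trans (le_normr_Rintegral _ ig))// -Rintegral_itv_cst//.
have cM : continuous (fun _ : R => M) by move=> ?; exact: cst_continuous.
have cng : continuous (fun t => `|g t|).
  by move=> t; apply: continuous_comp; [exact: cg|exact: norm_continuous].
apply: le_Rintegral => //.
- exact: continuous_itv_integrable a b cng.
- exact: continuous_itv_integrable a b cM.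
Qed.

(** Values are taken at the left ends of [n.+1] equal steps, so the mesh is meaningful for every
    [n]. *)
Definition riemann_sum g a b (n : nat) : R :=
  \sum_(i < n.+1) g (a + (b - a) * (i%:R / n.+1%:R)) * ((b - a) / n.+1%:R).

Lemma Rintegral_itv_sum g (t : nat -> R) n : continuous g ->
  (forall i, (i < n)%N -> t i <= t i.+1) ->
  \int[mu]_(s in `[t 0%N, t n]) g s = \sum_(i < n) \int[mu]_(s in `[t i, t i.+1]) g s.
Proof.
move=> cg; elim: n => [|n IH] tt; first by rewrite big_ord0 set_itv1 Rintegral_set1.
rewrite big_ord_recr/= -IH => [|i ni]; last by apply: tt; rewrite ltnS ltnW.
apply: Rintegral_itv_cat => //; last exact: tt.
have : forall k, (k <= n)%N -> t 0%N <= t k.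
  elim=> // k IHk kn; rewrite (le_trans (IHk (ltnW kn)))// tt//.
  exact: ltnW.
by apply.
Qed.

(** Around each point the estimate holds for all large [n]; compactness of the segment, in its
    near-covering form, makes the threshold on [n] uniform. *)
Lemma unif_cont_itv g a b (e : R) : continuous g -> a < b -> 0 < e ->
  \forall n \near \oo, forall s t, s \in `[a, b] -> `|s - t| <= (b - a) / n.+1%:R ->
    `|g s - g t| <= e.
Proof.
move=> cg ab e0.
have := @segment_compact _ a b.
move=> /compact_near_coveringP/(_ nat \oo
  (fun n s => forall t, `|s - t| <= (b - a) / n.+1%:R -> `|g s - g t| <= e)).
have key : forall x, x \in `[a, b] -> \forall x' \near x & n \near \oo,
  forall t, `|x' - t| <= (b - a) / n.+1%:R -> `|g x' - g t| <= e.
  move=> x _.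
  have /cvgrPdist_lt/(_ (e / 2)) := cg x.
  rewrite divr_gt0// => /(_ isT) [r /= r0 xr].
  near=> x' n => t x't.
  have ? : `|x - x'| < r / 2 by near: x'; apply: cvgr_dist_lt => //; rewrite divr_gt0.
  have nr : (b - a) / n.+1%:R < r / 2.
    near: n.
    have r2 : 0 < r / 2 / (b - a) by rewrite !divr_gt0// subr_gt0.
    apply: filterS (near_infty_natSinv_lt (PosNum r2)) => m /=.
    by rewrite ltr_pdivlMr ?subr_gt0// mulrC.
  have h1 : `|x - x'| < r by lra.
  have x't2 := le_lt_trans x't nr.
  have h2 : `|x - t| < r.
    rewrite (le_lt_trans (ler_distD x' _ _))//; lra.
  have := xr _ h1; have := xr _ h2 => h3 h4.
  rewrite (le_trans (ler_distD (g x) _ _))// (distrC (g x')); lra.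
move=> /(_ _ key); apply: filterS => n H s t sab; apply: H.
exact: sab.
Unshelve. all: by end_near. Qed.

Lemma Rintegral_itv_approx g a b r e : continuous g -> a <= b ->
  (forall t, t \in `[a, b] -> `|g t - r| <= e) ->
  `|\int[mu]_(t in `[a, b]) g t - r * (b - a)| <= e * (b - a).
Proof.
move=> cg ab gr; have cr : continuous (fun _ : R => r).
  by move=> ?; exact: cst_continuous.
rewrite -Rintegral_itv_cst// -RintegralB//; last 2 first.
- exact: continuous_itv_integrable.
- exact: continuous_itv_integrable a b cr.
apply: (Rintegral_itv_bound _ ab gr) => t.
by apply: cvgB; [exact: cg|exact: cvg_cst].
Qed.

Lemma riemann_sum_cvg g a b : continuous g -> a < b ->
  riemann_sum g a b n @[n --> \oo] --> \int[mu]_(s in `[a, b]) g s.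
Proof.
move=> cg ab; apply/cvgrPdist_le => e e0.
have ba0 : 0 < b - a by rewrite subr_gt0.
have := unif_cont_itv cg ab (divr_gt0 e0 ba0); apply: filterS => n ug.
pose t i := a + (b - a) * (i%:R / n.+1%:R).
have tS i : t i.+1 - t i = (b - a) / n.+1%:R.
  by rewrite /t -natr1; field.
have h0 : 0 < (b - a) / n.+1%:R by rewrite divr_gt0.
have tle i : t i <= t i.+1 by rewrite -subr_ge0 tS ltW.
have tn : t n.+1 = b by rewrite /t divff// mulr1 addrC subrK.
have t0 : t 0%N = a by rewrite /t mul0r mulr0 addr0.
have tab i : (i <= n)%N -> t i \in `[a, b].
  move=> ni; rewrite in_itv/= /t lerDl mulr_ge0 ?(ltW ba0)//=.
  rewrite -lerBrDl ler_piMr ?(ltW ba0)// ler_pdivrMr// mul1r ler_nat.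
  exact: leqW.
rewrite -{1}t0 -{1}tn (Rintegral_itv_sum cg)// -sumrB.
rewrite (le_trans (ler_norm_sum _ _ _))//.
(* The error [e] is shared among the steps in proportion to their lengths, which telescope to
   [b - a]. *)
rewrite [leRHS](_ : e = \sum_(i < n.+1) (e / (b - a) * (t i.+1 - t i))); last first.
  rewrite -mulr_sumr -(big_mkord xpredT (fun i => t i.+1 - t i)).
  by rewrite telescope_sumr// tn t0 divfK// gt_eqF.
apply: ler_sum => i _; rewrite -(tS i) -/(t i).
apply: Rintegral_itv_approx => // s; rewrite in_itv/= => /andP[tis sti].
rewrite distrC; apply: ug; first by apply: tab; rewrite -ltnS.
by rewrite distrC ger0_norm ?subr_ge0// -(tS i) lerB.
Qed.

(** Joint continuity and compactness of [[a, b]] make the continuity in [r] uniform in [s]. *)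
Lemma continuous_Rintegral_param (q : R -> R -> R) a b :
  continuous (fun p : R * R => q p.1 p.2) -> a <= b ->
  continuous (fun r => \int[mu]_(s in `[a, b]) q s r).
Proof.
move=> cq ab r.
have cq1 r' : continuous (q ^~ r').
  move=> s; apply: (@continuous_comp _ _ _ (fun s => (s, r')) (fun p => q p.1 p.2)).
    by apply: continuous_pair => ?; [exact: cvg_id|exact: cst_continuous].
  exact: cq.
apply/cvgrPdist_le => e e0.
(* The added 1 keeps the denominator positive when [a = b]. *)
have e'0 : 0 < e / (b - a + 1) by rewrite divr_gt0// ltr_wpDl// subr_ge0.
have key s : s \in `[a, b] -> \forall s' \near s & r' \near r,
    `|q s' r - q s' r'| <= e / (b - a + 1).
  move=> _; have /cvgrPdist_lt/(_ (e / (b - a + 1) / 2)) := cq (s, r).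
  rewrite divr_gt0// => /(_ isT) [[A B] [/= sA rB] AB].
  exists (A, B) => // -[s' r'] [/= As' Br'].
  have h1 := AB (s', r') (conj As' Br').
  have h2 := AB (s', r) (conj As' (nbhs_singleton rB)).
  rewrite /= in h1 h2.
  rewrite (le_trans (ler_distD (q s r) _ _))// (distrC (q s' r)); lra.
have /compact_near_coveringP/(_ _ (nbhs r)
  (fun r' s => `|q s r - q s r'| <= e / (b - a + 1)) _ key) := @segment_compact _ a b.
apply: filterS => r' qr'.
rewrite -RintegralB//; last 2 first.
- exact: continuous_itv_integrable.
- exact: continuous_itv_integrable.
apply: (@le_trans _ _ (e / (b - a + 1) * (b - a))).
  by apply: Rintegral_itv_bound => // t; apply: cvgB; exact: cq1.
by rewrite mulrAC ler_pdivrMr ?ltr_wpDl ?subr_ge0// ler_pM2l// lerDl.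
Qed.

(** Differentiation of the integral at [a] along a sequence: if [g a] were nonzero, [g] would stay
    within [|g a| / 2] of it near [a], and the integrals over short segments could not vanish. *)
Lemma Rintegral_right_eq0 g a (b : nat -> R) : continuous g ->
  (forall n, a < b n) -> b n @[n --> \oo] --> a ->
  (forall n, \int[mu]_(s in `[a, b n]) g s = 0) -> g a = 0.
Proof.
move=> cg ab ba g0; apply/eqP/negPn/negP => ga0.
have e0 : 0 < `|g a| / 2 by rewrite divr_gt0// normr_gt0.
have /cvgrPdist_le/(_ _ e0)[r /= r0 ar] := cg a.
have /cvgrPdist_lt/(_ _ r0)[n _ /(_ n (leqnn n)) /=] := ba.
rewrite distrC gtr0_norm ?subr_gt0// => bnr.
have bna : 0 < b n - a by rewrite subr_gt0.
have := @Rintegral_itv_approx g a (b n) (g a) (`|g a| / 2) cg (ltW (ab n)).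
rewrite g0 sub0r normrN normrM (gtr0_norm bna) ler_pM2r// => h.
suff : `|g a| <= `|g a| / 2 by lra.
apply: h => t; rewrite in_itv/= => /andP[at_ tb]; rewrite distrC; apply: ar => /=.
by rewrite distrC ger0_norm ?subr_ge0//; lra.
Qed.

End continuous_integral.

(** * Passage from almost every Gaussian value to every value *)

(** For almost every [w], the section at [w] of the exceptional null set is Gaussian null. It
    contains the set of [z] violating the bound, which is open by continuity of [V w], hence empty
    by full support. *)
Lemma ae_prod_normal_continuous (R : realType) d (T : measurableType d)
    (P : probability T R) (s : R) (V : T -> R -> R) (c : R) :
  0 < s -> (forall w, continuous (V w)) ->
  {ae (P \x normal_prob 0 s)%E, forall p, `|V p.1 p.2| <= c} ->
  {ae P, forall w, forall z, `|V w z| <= c}.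
Proof.
move=> s0 cV [B [mB B0 VB]].
have mN : measurable_fun setT (fun w => normal_prob 0 s (xsection B w)).
  exact: measurable_fun_xsection.
have : (\int[P]_w `|normal_prob 0 s (xsection B w)| = 0)%E.
  rewrite -[RHS]B0; apply: eq_integral => w _.
  by rewrite gee0_abs.
move=> /(ae_eq_integral_abs P measurableT mN); apply: filterS => w /= /(_ I) Bw z.
rewrite leNgt; apply/negP => cVz.
have oO : open [set z | c < `|V w z|].
  rewrite (_ : [set z | _] = (fun z => `|V w z|) @^-1` [set x | c < x]) //.
  apply: open_comp; last exact: open_gt.
  by move=> y _; apply: continuous_comp; [exact: cV|exact: norm_continuous].
have := normal_prob_open_gt0 s0 oO cVz.
suff : (normal_prob 0 s [set z | (c < `|V w z|)%R] <= normal_prob 0 s (xsection B w))%E.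
  by rewrite Bw => h /lt_le_trans /(_ h); rewrite ltxx.
rewrite le_measure ?inE//; [exact: open_measurable|exact: measurable_xsection|].
move=> y /= cy; rewrite /xsection/= inE; apply: VB => /=.
by apply/negP; rewrite -ltNge.
Qed.

(** * Extension of functions on [[0, T]] to the whole time axis *)

Lemma continuous_within_comp (T U V : topologicalType) (A : set U) (f : U -> V) (h : T -> U) :
  {within A, continuous f} -> continuous h -> (forall x, A (h x)) ->
  continuous (f \o h).
Proof.
move=> /subspace_continuousP cf ch Ah x W fW.
have := ch x _ (cf _ (Ah x) _ fW); rewrite /nbhs/=.
by apply: filterS => y /=; apply; exact: Ah.
Qed.

Section clamp.
Context {R : realType}.
Variable T : R.
Hypothesis T0 : 0 <= T.

(** A path set to 0 outside [[0, T]] may jump at [T]; composed with this retraction onto [[0, T]] it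
    is continuous on all of [R]. *)
Definition clamp (s : R) : R := Num.max 0 (Num.min s T).

Lemma clamp_in s : clamp s \in `[0, T].
Proof. by rewrite in_itv/= le_max lexx ge_max T0 ge_min lexx orbT. Qed.

Lemma clamp_id s : s \in `[0, T] -> clamp s = s.
Proof. by rewrite in_itv/= => /andP[s0 sT]; rewrite /clamp min_l// max_r. Qed.

Lemma clamp_continuous : continuous clamp.
Proof.
move=> s; apply: (@continuous_max _ _ (cst 0) (fun s => Num.min s T)).
  exact: cst_continuous.
apply: (@continuous_min _ _ idfun (cst T)); first exact: cvg_id.
exact: cst_continuous.
Qed.

End clamp.

(** * The functional of a path shifted from time [b] on *)

Section path_functional.
Context {R : realType} {d : nat}.
Notation mu := (@lebesgue_measure R).
Variables (T a b : R) (g1 : 'rV[R]_d -> R) (g2 : R -> 'rV[R]_d -> R).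
Hypotheses (a0 : 0 < a) (ab : a < b) (bT : b < T).
Hypotheses (cg1 : continuous g1) (cg2 : continuous (fun p : R * 'rV[R]_d => g2 p.1 p.2)).

Lemma continuous_g2_path (u : R -> 'rV[R]_d) (v : 'rV[R]_d) : continuous u ->
  continuous (fun s => g2 s (u s + v)).
Proof.
move=> cu s; apply: (@continuous_comp _ _ _ (fun s => (s, u s + v)) (fun p => g2 p.1 p.2)).
  apply: continuous_pair => t; first exact: cvg_id.
  by apply: cvgD; [exact: cu|exact: cvg_cst].
exact: cg2.
Qed.

(** The shift [v] acts from time [b] on only, and the values of [u] strictly between [a] and [b] do
    not enter: this is what lets the increment over [[a, b]] be changed freely. *)
Definition path_functional (u : R -> 'rV[R]_d) (v : 'rV[R]_d) : R :=
  g1 (u T + v) - \int[mu]_(s in `[0, a]) g2 s (u s)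
               - \int[mu]_(s in `[b, T]) g2 s (u s + v).

Lemma path_functional_continuous (u : R -> 'rV[R]_d) (e : 'rV[R]_d) : continuous u ->
  continuous (fun r : R => path_functional u (r *: e)).
Proof.
move=> cu r; apply: cvgB.
  apply: cvgB; last exact: cvg_cst.
  apply: continuous_comp; last exact: cg1.
  by apply: cvgD; [exact: cvg_cst|exact: cvgZr_tmp].
apply: (@continuous_Rintegral_param _ (fun (s r : R) => g2 s (u s + r *: e)))
  => [p|]; last exact: ltW.
apply: (@continuous_comp _ _ _ (fun p : R * R => (p.1, u p.1 + p.2 *: e)) (fun p => g2 p.1 p.2)).
  apply: continuous_pair => t; first exact: cvg_fst.
  apply: cvgD; first by apply: continuous_comp; [exact: cvg_fst|exact: cu].
  by apply: cvgZr_tmp; exact: cvg_snd.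
exact: cg2.
Qed.

End path_functional.

(** * Discretization in time, as a function of finitely many increments *)

Section discretization.
Context {R : realType} {d : nat}.
Variables (T a b : R) (n : nat).
Hypotheses (a0 : 0 < a) (ab : a < b) (bT : b < T).

(* [0, a] and [b, T] are each cut into [n.+1] equal steps, while [a, b] is a
   single step, of index [n.+1]. *)
Definition node (k : nat) : R :=
  if (k <= n.+1)%N then a * (k%:R / n.+1%:R)
  else b + (T - b) * ((k - n.+2)%:R / n.+1%:R).

Notation N := (n.+2 + n.+1)%N.

Lemma node0 : node 0 = 0.
Proof. by rewrite /node/= mul0r mulr0. Qed.

Lemma node_left : node n.+1 = a.
Proof. by rewrite /node leqnn divff// mulr1. Qed.

Lemma node_shift i : node (n.+2 + i) = b + (T - b) * (i%:R / n.+1%:R).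
Proof. by rewrite /node addKn ifN// -ltnNge addSn ltnS leq_addr. Qed.

Lemma node_right : node n.+2 = b.
Proof. by rewrite -[n.+2]addn0 node_shift mul0r mulr0 addr0. Qed.

Lemma node_last : node N = T.
Proof. by rewrite node_shift divff// mulr1 addrC subrK. Qed.

Lemma node_lt k : node k < node k.+1.
Proof.
have [kn|nk|->] := ltngtP k n.+1.
- rewrite /node kn (ltnW kn) ltr_pM2l// ltr_pM2r ?invr_gt0// ltr_nat.
  exact: ltnSn.
- rewrite -(subnKC nk) -addnS !node_shift ltrD2l ltr_pM2l ?subr_gt0//.
  by rewrite ltr_pM2r ?invr_gt0// ltr_nat.
- by rewrite node_left node_right.
Qed.

Lemma node_le i k : (i <= k)%N -> node i <= node k.
Proof.
elim: k => [|k IH]; first by rewrite leqn0 => /eqP ->.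
rewrite leq_eqVlt => /predU1P[->//|ik].
by rewrite (le_trans (IH ik))// ltW// node_lt.
Qed.

Lemma node_in k : (k <= N)%N -> node k \in `[0, T].
Proof.
by move=> kN; rewrite in_itv/= -{1}node0 node_le//= -node_last node_le.
Qed.

Notation idx := ('I_N * 'I_d)%type.

Definition path_incr (u : R -> 'rV[R]_d) : idx -> R :=
  fun ij => u (node ij.1.+1) 0 ij.2 - u (node ij.1) 0 ij.2.

(** The position at the [k]-th node of the path started at 0; it inverts [path_incr] by
    telescoping. *)
Definition path_of_incr (X : idx -> R) (k : nat) : 'rV[R]_d :=
  \row_j \sum_(i < N | (i < k)%N) X (i, j).

Lemma path_of_incrK u k : u 0 = 0 -> (k <= N)%N ->
  path_of_incr (path_incr u) k = u (node k).
Proof.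
move=> u0 kN; apply/rowP => j; rewrite mxE /path_incr/=.
rewrite -(big_ord_widen _ (fun i => u (node i.+1) 0 j - u (node i) 0 j) kN).
rewrite -(big_mkord xpredT (fun i => u (node i.+1) 0 j - u (node i) 0 j)).
by rewrite telescope_sumr// node0 u0 mxE subr0.
Qed.

Lemma mid_subproof : (n.+1 < N)%N.
Proof. by rewrite addSn ltnS leq_addr. Qed.

Definition mid : 'I_N := Ordinal mid_subproof.

(** Only partial sums reaching past the step [mid] contain the resampled increment, so every node
    from [b] on is translated by one and the same vector. *)
Lemma path_of_resample X (j0 : 'I_d) z k :
  path_of_incr (resample (mid, j0) X z) k = path_of_incr X k +
    (if (n.+1 < k)%N then (z - X (mid, j0)) *: delta_mx 0 j0 else 0).
Proof.
apply/rowP => j; rewrite !mxE.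
have [nk|kn] := ltnP n.+1 k; last first.
  rewrite mxE addr0; apply: eq_bigr => i ik; rewrite /resample xpair_eqE.
  case: eqP => //= im; move: ik; rewrite im /= => h.
  by have := leq_trans h kn; rewrite ltnn.
rewrite !mxE eqxx/= (bigD1 mid)//= [in RHS](bigD1 mid)//=.
rewrite (eq_bigr (fun i => X (i, j))) => [|i /andP[_ im]]; last first.
  by rewrite /resample xpair_eqE (negbTE im).
rewrite /resample xpair_eqE eqxx/=.
by case: eqP => [->|_]; rewrite ?mulr1 ?mulr0; ring.
Qed.

(** The Riemann-sum version of [path_functional], written through the increments alone so that their
    joint law determines its law. *)
Definition discrete_functional (g1 : 'rV[R]_d -> R) (g2 : R -> 'rV[R]_d -> R)
    (X : idx -> R) : R :=
  g1 (path_of_incr X N)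
  - \sum_(i < n.+1) g2 (node i) (path_of_incr X i) * (a / n.+1%:R)
  - \sum_(i < n.+1) g2 (node (n.+2 + i)) (path_of_incr X (n.+2 + i)) *
      ((T - b) / n.+1%:R).

Lemma discrete_functional_resample g1 g2 (u : R -> 'rV[R]_d) (j0 : 'I_d) z :
  u 0 = 0 ->
  let v := (z - (u b 0 j0 - u a 0 j0)) *: delta_mx 0 j0 in
  discrete_functional g1 g2 (resample (mid, j0) (path_incr u) z) =
  g1 (u T + v) - riemann_sum (fun s => g2 s (u s)) 0 a n
               - riemann_sum (fun s => g2 s (u s + v)) b T n.
Proof.
move=> u0 v; rewrite /discrete_functional.
have pv k : (k <= N)%N -> path_of_incr (resample (mid, j0) (path_incr u) z) k =
    u (node k) + if (n.+1 < k)%N then v else 0.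
  move=> kN; rewrite path_of_resample path_of_incrK//.
  by rewrite /path_incr/= node_left node_right.
rewrite pv// mid_subproof node_last; congr (_ - _ - _).
  (* The left ends of the steps of [[0, a]] have index at most [n], so they precede the resampled
     step and do not move. *)
  rewrite /riemann_sum; apply: eq_bigr => i _.
  have iN : (i <= N)%N by rewrite (leq_trans (ltnW (ltn_ord i)))// leq_addl.
  by rewrite pv// ltnNge (ltnW (ltn_ord i))/= addr0 subr0 /node (ltnW (ltn_ord i)) add0r.
rewrite /riemann_sum; apply: eq_bigr => i _.
have ni : (n.+1 < n.+2 + i)%N by rewrite addSn ltnS leq_addr.
by rewrite pv ?leq_add2l 1?(ltnW (ltn_ord i))// ni node_shift.
Qed.

Lemma resample_id (I : finType) (X : I -> R) i0 : resample i0 X (X i0) = X.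
Proof. by apply/funext => i; rewrite /resample; case: eqP => [->|]. Qed.

Lemma measurable_discrete_functional g1 g2 :
  continuous g1 -> continuous (fun p : R * 'rV[R]_d => g2 p.1 p.2) ->
  measurable_fun setT (discrete_functional g1 g2 : box_space R idx -> R).
Proof.
move=> cg1 cg2.
have mp k j : measurable_fun setT (fun X : box_space R idx => path_of_incr X k 0 j).
  rewrite (_ : (fun X : box_space R idx => path_of_incr X k 0 j) =
      (fun X : box_space R idx => \sum_(i < N) if (i < k)%N then X (i, j) else 0)).
    by apply: measurable_sum => i; case: (i < k)%N => //; exact: box_space_coord.
  by apply/funext => X; rewrite mxE big_mkcond.
have mg s k : measurable_fun setT (fun X : box_space R idx => g2 s (path_of_incr X k)).
  apply: (measurable_continuous_rV (Y := fun X : box_space R idx => path_of_incr X k)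
    (f := g2 s)) => //.
  move=> y; apply: (@continuous_comp _ _ _ (fun y => (s, y)) (fun p => g2 p.1 p.2)).
    by apply: continuous_pair => t; [exact: cst_continuous|exact: cvg_id].
  exact: cg2.
apply: measurable_funB; first apply: measurable_funB.
- exact: (measurable_continuous_rV (Y := fun X : box_space R idx => path_of_incr X N)).
- by apply: measurable_sum => i; apply: measurable_funM.
- by apply: measurable_sum => i; apply: measurable_funM.
Qed.

End discretization.

(** * Resampling an increment under Wiener measure *)

Section wiener.
Context {R : realType} {d : nat}.
Variables (T : R) (T0 : 0 < T) (P : probability (path_space T d) R).
Hypothesis wP : is_wiener_measure P.

Let W (w : path_space T d) : R -> 'rV[R]_d := (w : path0 T d) \o clamp T.

Lemma clamped_path_continuous w : continuous (W w).
Proof.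
apply: continuous_within_comp; first exact: path0_continuous.
- exact: clamp_continuous.
- by move=> s; exact: clamp_in (ltW T0) s.
Qed.

Lemma clamped_path0 w : W w 0 = 0.
Proof. by rewrite /W /= clamp_id ?in_itv/= ?lexx ?ltW// path0_start. Qed.

Lemma measurable_path_coord t j : t \in `[0, T] ->
  measurable_fun setT (fun w : path_space T d => (w : path0 T d) t 0 j).
Proof.
move=> tT _ B mB; rewrite setTI; apply: sub_sigma_algebra.
by exists t, j, B.
Qed.

Lemma measurable_increment s t j : s \in `[0, T] -> t \in `[0, T] ->
  measurable_fun setT (@increment R T d s t j).
Proof. by move=> sT tT; apply: measurable_funB; exact: measurable_path_coord. Qed.

Variables (a b : R).
Hypotheses (a0 : 0 < a) (ab : a < b) (bT : b < T).

Lemma increment_node n (i : 'I_(n.+2 + n.+1)) j w :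
  increment (node T a b n i) (node T a b n i.+1) j w = path_incr T a b (W w) (i, j).
Proof.
by rewrite /increment /path_incr /W /= !clamp_id// node_in// ltnW.
Qed.

(** For each [n], the discrete functionals of the true and of the resampled increments have the same
    law. Both converge by Riemann sums, so the bound passes to the path shifted by a random multiple
    of [delta_mx 0 j0], and continuity in the shift with full support of the Gaussian gives all
    multiples. *)
Lemma path_functional_resample (g1 : 'rV[R]_d -> R) (g2 : R -> 'rV[R]_d -> R) (j0 : 'I_d) (c : R) :
  continuous g1 -> continuous (fun p : R * 'rV[R]_d => g2 p.1 p.2) ->
  {ae P, forall w, `|path_functional T a b g1 g2 (W w) 0| <= c} ->
  {ae P, forall w, forall r, `|path_functional T a b g1 g2 (W w) (r *: delta_mx 0 j0)| <= c}.
Proof.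
move=> cg1 cg2 Pc.
pose xi w := W w b 0 j0 - W w a 0 j0.
pose X n (ij : 'I_(n.+2 + n.+1) * 'I_d) (w : path_space T d) : R :=
  increment (node T a b n ij.1) (node T a b n ij.1.+1) ij.2 w.
have XE n (w : path_space T d) : (fun ij => X n ij w) = path_incr T a b (W w).
  by apply/funext => -[i j]; rewrite /X increment_node.
have mX n ij : measurable_fun setT (X n ij).
  by apply: measurable_increment; apply: node_in => //; rewrite ltnW.
pose U n (w : path_space T d) := discrete_functional T a b g1 g2 (fun ij => X n ij w).
pose V n (p : path_space T d * measurableTypeR R) :=
  discrete_functional T a b g1 g2 (resample (mid n, j0) (fun ij => X n ij p.1) p.2).
(* Putting [z] in place of the increment [xi] translates the path by [z - xi] from time [b] on. *)
pose v (p : path_space T d * measurableTypeR R) : R :=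
  path_functional T a b g1 g2 (W p.1) ((p.2 - xi p.1) *: delta_mx 0 j0).
have mD n := measurable_discrete_functional T a b (n := n) cg1 cg2.
have limV p : V n p @[n --> \oo] --> v p.
  rewrite /V /v; under eq_fun do rewrite XE discrete_functional_resample ?clamped_path0//.
  have cW := @clamped_path_continuous p.1.
  apply: cvgB; first apply: cvgB; first exact: cvg_cst.
  - apply: riemann_sum_cvg => //.
    have := continuous_g2_path cg2 (v := 0) cW.
    by under eq_fun do rewrite addr0.
  - by apply: riemann_sum_cvg => //; exact: continuous_g2_path.
(* Resampling with the value already present changes nothing. Hence the limit of [U n] is [v] on the
   graph of [xi], where the shift is zero. *)
have UV n (w : path_space T d) : U n w = V n (w, xi w).
  have <- : X n (mid n, j0) w = xi w.
    have := congr1 (fun F => F (mid n, j0)) (XE n w) => /= ->.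
    by rewrite /path_incr/= node_left node_right.
  by rewrite /V /= (resample_id (fun ij => X n ij w)).
have Poo : (P setT < +oo)%E by rewrite probability_setT ltry.
have Qoo : ((P \x normal_prob 0 (Num.sqrt (b - a))) (setT `*` setT) < +oo)%E.
  rewrite product_measure1E//; apply: (@le_lt_trans _ _ (1 * 1)%E).
    by apply: lee_pmul => //; exact: probability_le1.
  by rewrite mule1 ltry.
have : {ae (P \x normal_prob 0 (Num.sqrt (b - a)))%E, forall p, `|v p| <= c}.
  apply: (limit_law_ae_le (P1 := P)
    (P2 := (P \x normal_prob 0 (Num.sqrt (b - a)))%E)
    (U := U) (u := fun w => v (w, xi w)) (V := V) (v := v)) => //.
  - by move: Qoo; rewrite setXTT; apply.
  - move=> n; exact: (measurableT_comp (mD n) (measurable_into_boxes (mX n))).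
  - move=> n; apply: (measurableT_comp (mD n) (measurable_into_boxes _)) => ij.
    rewrite /resample; case: (ij == _); first exact: measurable_snd.
    exact: (measurableT_comp (mX n ij) measurable_fst).
  - move=> n A mA.
    have mDA := mD n measurableT _ mA; rewrite setTI in mDA.
    have := resample_law (P := P) (N := normal_prob 0 (Num.sqrt (b - a)))
      (i0 := (mid n, j0)) (mX n) _ _ mDA.
    apply.
    + apply: (wP.2 (n.+2 + n.+1)%N (node T a b n)); first by rewrite node0.
        by move=> i _; exact: node_lt.
      by rewrite node_last.
    + move=> B mB; rewrite /X/= node_left node_right.
      by apply: wP.1 => //; exact: ltW.
  - by move=> w; under eq_fun do rewrite UV; exact: limV.
  - by apply: filterS Pc => w; rewrite /v/= subrr scale0r.
move=> /(@ae_prod_normal_continuous _ _ _ P _ (fun w z => v (w, z))) h.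
have ba0 : 0 < Num.sqrt (b - a) by rewrite sqrtr_gt0 subr_gt0.
have cv (w : path_space T d) : continuous (fun z : R => v (w, z)).
  move=> z; apply: (@continuous_comp _ _ _ (fun z : R => z - xi w)
    (fun r : R => path_functional T a b g1 g2 (W w) (r *: delta_mx 0 j0))).
    by apply: cvgB; [exact: cvg_id|exact: cvg_cst].
  exact: path_functional_continuous (@clamped_path_continuous w) _.
(* For fixed [w] the shift [z - xi w] takes every real value; [z = r + xi w] yields the shift
   [r]. *)
apply: filterS (h ba0 cv) => w vc r.
by have := vc (r + xi w); rewrite /v /= addrK.
Qed.

End wiener.

(** * Full support of the position at a positive time, and auxiliary limits *)

(** If [k y] is nonzero, so is [k] on an open box around [y]. The coordinates of [w b] are
    independent Gaussians of positive variance, so [w b] lies in that box with positive probability,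
    against the hypothesis. *)
Lemma wiener_full_support (R : realType) (d : nat) (T b : R)
    (P : probability (path_space T d) R) (k : 'rV[R]_d -> R) :
  is_wiener_measure P -> 0 < b -> b <= T -> continuous k ->
  {ae P, forall w : path0 T d, k (w b) = 0} -> forall y, k y = 0.
Proof.
move=> wP b0 bT ck [A [mA A0 kA]] y; apply/eqP/negPn/negP => ky.
have [B yB Bk] : nbhs y (k @^-1` [set z | z != 0]).
  by apply: (ck y); apply: open_nbhs_nbhs; split; [exact: open_neq|exact: ky].
pose O (j : 'I_d) : set R := (B 0 j)°.
have oO j : open (O j) by exact: open_interior.
have Oy j : O j (y 0 j) by exact: yB.
have mO (j : 'I_d) : measurable (O j) by exact: open_measurable.
(* A single step from 0 to [b]: as paths start at 0, its increments are the coordinates of [w b]. *)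
pose t (i : nat) : R := if i == 0%N then 0 else b.
have indep := wP.2 1%N t (lexx 0).
have {}indep : mutually_independent P
    (fun ij : 'I_1 * 'I_d => increment (t ij.1) (t ij.1.+1) ij.2).
  by apply: indep => // -[].
have := indep [set: _]%SET (fun ij => O ij.2) (fun ij => mO ij.2).
have sb : 0 < Num.sqrt b by rewrite sqrtr_gt0.
have -> : [set w : path_space T d | forall ij : 'I_1 * 'I_d, ij \in [set: 'I_1 * 'I_d]%SET ->
    O ij.2 (increment (t ij.1) (t ij.1.+1) ij.2 w)] =
    [set w : path_space T d | forall j, O j ((w : path0 T d) b 0 j)].
  apply/seteqP; split => w /= h.
    move=> j; have := h (ord0, j); rewrite inE /increment /t/= path0_start mxE subr0.
    exact.
  by move=> [i j] _; rewrite ord1 /increment /t/= path0_start mxE subr0; exact: h.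
move=> PE; suff : (0 < P A)%E by rewrite A0 ltxx.
apply: (@lt_le_trans _ _ (P [set w : path_space T d | forall j, O j ((w : path0 T d) b 0 j)])).
  rewrite PE; elim/big_ind: _ => [|u v u0 v0|[i j] _]; first exact: lte01.
    exact: mule_gt0.
  rewrite ord1 /= wP.1// subr0.
  exact: normal_prob_open_gt0 sb (oO j) (Oy j).
rewrite le_measure ?inE//.
  rewrite (_ : [set w | _] = \bigcap_(j in [set: 'I_d])
      [set w : path_space T d | O j ((w : path0 T d) b 0 j)]).
    apply: fin_bigcap_measurable => // j _.
    have := @measurable_path_coord R d T b j _ measurableT _ (mO j).
    by rewrite setTI; apply; rewrite in_itv/= ltW.
  by apply/seteqP; split => w /= h j; [move=> _|]; apply: h.
move=> w /= Ow; apply: kA => /= kw.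
have := Bk (w b); rewrite /= kw eqxx => h; suff : false by [].
by apply: h => i j; rewrite ord1; apply: interior_subset; exact: Ow.
Qed.

Lemma continuous_seq_eq0 (R : realType) (G : R -> R) (h : nat -> R) (l : R) :
  continuous G -> h n @[n --> \oo] --> l -> (forall n, G (h n) = 0) -> G l = 0.
Proof.
move=> cG hl Gh; have : G (h n) @[n --> \oo] --> G l.
  by apply: continuous_cvg => //; exact: cG.
under eq_fun do rewrite Gh; move=> /cvg_lim <- //.
by rewrite lim_cst.
Qed.

Lemma constant_of_delta_shift (R : realType) (d : nat) (f : 'rV[R]_d -> R) :
  (forall y r j, f (y + r *: delta_mx 0 j) = f y) -> forall y, f y = f 0.
Proof.
move=> fE y; rewrite [y]row_sum_delta.
by apply: (big_rec (fun z => f z = f 0)) => // j z _ <-; rewrite addrC fE.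
Qed.

(** Supplies sequences tending to an endpoint from inside an interval: the denominator [n.+2] makes
    the fraction of the length strictly less than 1 from [n = 0] on. *)
Lemma cvg_shrink (R : realType) (l c : R) : l + c / n.+2%:R @[n --> \oo] --> l.
Proof.
rewrite -[X in _ --> X]addr0 -[in X in _ --> X](mulr0 c); apply: cvgD; first exact: cvg_cst.
apply: cvgM; first exact: cvg_cst.
by have := @cvg_harmonic R; rewrite -cvg_shiftS.
Qed.

(** * Invariance of the drift under spatial shifts, at interior times *)

Section shift_invariance.
Context {R : realType} {d : nat}.
Notation mu := (@lebesgue_measure R).
Variables (T : R) (T0 : 0 < T) (P : probability (path_space T d) R).
Hypothesis wP : is_wiener_measure P.
Variables (g1 : 'rV[R]_d -> R) (g2 : R -> 'rV[R]_d -> R) (M : R).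
Hypotheses (cg1 : continuous g1) (cg2 : continuous (fun p : R * 'rV[R]_d => g2 p.1 p.2)).
Hypothesis g2M : forall s y, `|g2 s y| <= M.

Let W (w : path_space T d) : R -> 'rV[R]_d := (w : path0 T d) \o clamp T.

Hypothesis g12 : {ae P, forall w, g1 (W w T) = \int[mu]_(s in `[0, T]) g2 s (W w s)}.

Let cW w : continuous (W w) := @clamped_path_continuous R d T T0 w.

Let cgW w v : continuous (fun s => g2 s (W w s + v)) := continuous_g2_path cg2 (v := v) (@cW w).

Let cgW0 w : continuous (fun s => g2 s (W w s)).
Proof. by have := @cgW w 0; under eq_fun do rewrite addr0. Qed.

(** This is [path_functional] without the integral over [[0, a]], which does not depend on the shift
    and cancels in differences. *)
Let tail b (w : path_space T d) (v : 'rV[R]_d) :=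
  g1 (W w T + v) - \int[mu]_(s in `[b, T]) g2 s (W w s + v).

(** By [g12] the unshifted functional is almost surely the integral over [[a, b]], at most
    [M * (b - a)] in absolute value. Resampling extends the bound to all shifts, and the triangle
    inequality doubles it. *)
Lemma tail_shift_le a b j : 0 < a -> a < b -> b < T ->
  {ae P, forall w, forall r, `|tail b w (r *: delta_mx 0 j) - tail b w 0| <= M * (b - a) *+ 2}.
Proof.
move=> a0 ab bT.
have ae0 : {ae P, forall w, `|path_functional T a b g1 g2 (W w) 0| <= M * (b - a)}.
  apply: filterS g12 => w; rewrite /path_functional addr0 => ->.
  have -> : (fun s => g2 s (W w s + 0)) = (fun s => g2 s (W w s)).
    by apply/funext => s; rewrite addr0.
  rewrite (Rintegral_itv_cat (@cgW0 w) (ltW a0) (ltW (lt_trans ab bT))).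
  rewrite (Rintegral_itv_cat (@cgW0 w) (ltW ab) (ltW bT)).
  rewrite (_ : _ - _ - _ = \int[mu]_(s in `[a, b]) g2 s (W w s)); last by ring.
  by apply: Rintegral_itv_bound => //; exact: ltW.
have := path_functional_resample T0 wP a0 ab bT j cg1 cg2 ae0.
move=> aer; near=> w.
have h0 : `|path_functional T a b g1 g2 (W w) 0| <= M * (b - a) by near: w.
have hr : forall r, `|path_functional T a b g1 g2 (W w) (r *: delta_mx 0 j)| <= M * (b - a).
  by near: w.
move=> r; have -> : tail b w (r *: delta_mx 0 j) - tail b w 0 =
    path_functional T a b g1 g2 (W w) (r *: delta_mx 0 j) -
    path_functional T a b g1 g2 (W w) 0 by rewrite /tail /path_functional; ring.
by rewrite (le_trans (ler_normB _ _))// mulr2n lerD.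
Unshelve. all: by end_near. Qed.

Lemma tail_shift b j : 0 < b -> b < T ->
  {ae P, forall w, forall r, tail b w (r *: delta_mx 0 j) = tail b w 0}.
Proof.
move=> b0 bT.
(* The times [a n] increase to [b] inside []0, b[]; being countably many, their almost sure bounds
   hold simultaneously. *)
pose a n := b - b / n.+2%:R.
have a0 n : 0 < a n by rewrite subr_gt0 ltr_pdivrMr// ltr_pMr// ltr1n.
have ab n : a n < b by rewrite ltrBlDr ltrDl divr_gt0.
have /ae_foralln := fun n => tail_shift_le j (a0 n) (ab n) bT.
apply: filterS => w wr r; apply/eqP; rewrite -subr_eq0 -normr_le0.
have lim0 : M * (b - a n) *+ 2 @[n --> \oo] --> M * (b - b) *+ 2.
  apply: cvgMn; apply: cvgM; first exact: cvg_cst.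
  apply: cvgB; first exact: cvg_cst.
  have := @cvg_shrink R b (- b).
  by under eq_fun do rewrite mulNr.
rewrite subrr mulr0 mul0rn in lim0.
rewrite -(cvg_lim _ lim0)//; apply: limr_ge; first by apply/cvg_ex; exists 0.
by apply: nearW => n; exact: wr.
Qed.

(** Subtracting the tail identities at [b] and at [c n > b] shows that the drift difference [q] has
    zero integral over [[b, c n]]. Letting [c n] decrease to [b] gives the claim at [y = w b] almost
    surely, and full support of [w b] gives it at every [y]. *)
Lemma drift_shift b (y : 'rV[R]_d) r j : 0 < b -> b < T ->
  g2 b (y + r *: delta_mx 0 j) = g2 b y.
Proof.
move=> b0 bT; apply/eqP; rewrite -subr_eq0; apply/eqP; move: y.
have cg2b : continuous (g2 b).
  move=> y; apply: (@continuous_comp _ _ _ (fun y => (b, y)) (fun p => g2 p.1 p.2)).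
    by apply: continuous_pair => ?; [exact: cst_continuous|exact: cvg_id].
  exact: cg2.
have cs : continuous (fun y : 'rV[R]_d => y + r *: delta_mx 0 j).
  by move=> y; exact: (cvgD cvg_id (cvg_cst _)).
have csg : continuous (g2 b \o (fun y => y + r *: delta_mx 0 j)).
  by move=> y; apply: continuous_comp; [exact: cs|exact: cg2b].
apply: (wiener_full_support wP b0 (ltW bT)).
  by move=> y; exact: (cvgB (csg y) (cg2b y)).
pose c n := b + (T - b) / n.+2%:R.
have Tb0 : 0 < T - b by rewrite subr_gt0.
have bc n : b < c n by rewrite ltrDl divr_gt0.
have cT n : c n < T.
  by rewrite -ltrBrDl ltr_pdivrMr// ltr_pMr// ltr1n.
have /ae_foralln aec := fun n => tail_shift j (lt_trans b0 (bc n)) (cT n).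
have aeb := tail_shift j b0 bT.
suff : {ae P, forall w : path_space T d,
    (g2 b \o (fun y => y + r *: delta_mx 0 j)) ((w : path0 T d) b) -
    g2 b ((w : path0 T d) b) = 0} by [].
near=> w.
have hb : forall r, tail b w (r *: delta_mx 0 j) = tail b w 0 by near: w.
have hc : forall n r, tail (c n) w (r *: delta_mx 0 j) = tail (c n) w 0 by near: w.
have Wb : (w : path0 T d) b = W w b by rewrite /W/= clamp_id// in_itv/= !ltW.
rewrite Wb.
pose q s := g2 s (W w s + r *: delta_mx 0 j) - g2 s (W w s).
have cq : continuous q by move=> s; exact: (cvgB (@cgW w _ s) (@cgW0 w s)).
apply: (@Rintegral_right_eq0 _ q b c cq bc) => [|n]; first exact: cvg_shrink.
rewrite RintegralB//; last 2 first.
- exact: continuous_itv_integrable (@cgW w _).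
- exact: continuous_itv_integrable (@cgW0 w).
have := hb r; have := hc n r; rewrite /tail.
have -> : (fun s => g2 s (W w s + 0)) = (fun s => g2 s (W w s)).
  by apply/funext => s; rewrite addr0.
rewrite (Rintegral_itv_cat (@cgW w _) (ltW (bc n)) (ltW (cT n))).
rewrite (Rintegral_itv_cat (@cgW0 w) (ltW (bc n)) (ltW (cT n))).
lra.
Unshelve. all: by end_near. Qed.

End shift_invariance.

(** * Antiderivatives on [[0, T]] with one-sided derivatives at the ends *)

Section antiderivative.
Context {R : realType}.
Notation mu := (@lebesgue_measure R).
Variables (T : R) (T0 : 0 < T) (phi : R -> R).
Hypothesis cphi : continuous phi.

(** Properness makes the limit defining [derive_in] unique. Nearby points of [[0, T]] are found to
    the right of [t] if [t < T], and to the left if [t = T]. *)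
Lemma within_itv_dnbhs_proper t : t \in `[0, T] -> ProperFilter (within `[0, T] t^').
Proof.
rewrite in_itv/= => /andP[t0 tT]; apply: Build_ProperFilter_ex => A [r /= r0 tA].
have [tT'|Tt] := ltP t T.
- have m0 : 0 < Num.min r (T - t) by rewrite lt_min r0 subr_gt0.
  have mr : Num.min r (T - t) <= r by rewrite ge_min lexx.
  have mT : Num.min r (T - t) <= T - t by rewrite ge_min lexx orbT.
  exists (t + Num.min r (T - t) / 2); apply: tA => /=.
  + by rewrite ltr_norml; apply/andP; split; lra.
  + by apply/eqP; lra.
  + by rewrite in_itv/=; apply/andP; split; lra.
- have m0 : 0 < Num.min r T by rewrite lt_min r0.
  have mr : Num.min r T <= r by rewrite ge_min lexx.
  have mT : Num.min r T <= T by rewrite ge_min lexx orbT.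
  exists (t - Num.min r T / 2); apply: tA => /=.
  + by rewrite ltr_norml; apply/andP; split; lra.
  + by apply/eqP; lra.
  + by rewrite in_itv/=; apply/andP; split; lra.
Qed.

(** The quotient is the mean of [phi] between [t] and [s], which is within [e] of [phi t] once [s]
    is close to [t]. *)
Lemma integral_quotient_cvg (F : R -> R) (C : R) t : t \in `[0, T] ->
  (forall s, F s = C + \int[mu]_(u in `[0, s]) phi u) ->
  (F s - F t) / (s - t) @[s --> within `[0, T] t^'] --> phi t.
Proof.
rewrite in_itv/= => /andP[t0 tT] FE; apply/cvgrPdist_le => e e0.
have /cvgrPdist_le/(_ _ e0)[r /= r0 tr] := @cphi t.
exists r => //= s str st; rewrite in_itv/= => /andP[s0 sT].
have {}str : `|t - s| < r by [].
rewrite distrC -[X in `|_ - X|](mulfK (_ : s - t != 0)) ?subr_eq0//.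
rewrite -mulrBl normrM normfV ler_pdivrMr ?normr_gt0 ?subr_eq0// !FE.
have [lts|lst] := leP t s.
- rewrite (Rintegral_itv_cat cphi t0 lts) (ger0_norm (_ : 0 <= s - t)) ?subr_ge0//.
  rewrite (_ : _ + _ - _ - _ = \int[mu]_(u in `[t, s]) phi u - phi t * (s - t)); last by ring.
  apply: Rintegral_itv_approx => // u; rewrite in_itv/= => /andP[tu us].
  rewrite distrC; apply: tr => /=; rewrite distrC ger0_norm ?subr_ge0//.
  by move: str; rewrite distrC ger0_norm ?subr_ge0//; lra.
- rewrite (Rintegral_itv_cat cphi s0 (ltW lst)) distrC (distrC s)
    (gtr0_norm (_ : 0 < t - s)) ?subr_gt0//.
  rewrite (_ : _ - _ = \int[mu]_(u in `[s, t]) phi u - phi t * (t - s)); last by ring.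
  apply: Rintegral_itv_approx => //; first exact: ltW.
  move=> u; rewrite in_itv/= => /andP[su ut].
  rewrite distrC; apply: tr => /=; rewrite ger0_norm ?subr_ge0//.
  by move: str; rewrite ger0_norm ?subr_ge0 1?ltW//; lra.
Qed.

Lemma C1_antiderivative (c : R) :
  exists F, [/\ C1_in `[0, T] F,
    forall t, t \in `[0, T] -> derive_in `[0, T] F t = phi t & F T = c].
Proof.
(* The additive constant is chosen so that [F T = c]. *)
pose F t := (c - \int[mu]_(u in `[0, T]) phi u) + \int[mu]_(u in `[0, t]) phi u.
have Fcvg t (tT : t \in `[0, T]) := integral_quotient_cvg tT (fun s => erefl (F s)).
have Fder t : t \in `[0, T] -> derive_in `[0, T] F t = phi t.
  move=> tT; have := within_itv_dnbhs_proper tT => PF.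
  by apply: cvg_lim => //; exact: Fcvg.
exists F; split => //; last by rewrite /F subrK.
split => [t tT|]; first by apply/cvg_ex; exists (phi t); exact: Fcvg.
apply: (@subspace_eq_continuous _ _ _ phi).
  by move=> t; rewrite inE => tT; exact: (esym (Fder _ tT)).
exact: continuous_subspaceT.
Qed.

End antiderivative.

(** * Constancy of [f2] and [f1] in space, and the function [F] *)

Theorem lemma2p3 (R : realType) (d : nat) (eps T : R) (x : 'rV[R]_d)
    (mu0 : probability (path_space T d) R)
    (f1 : 'rV[R]_d -> R) (f2 : R -> 'rV[R]_d -> R)
    (heps : 0 < eps) (hT : 0 < T)
    (hmu0 : is_wiener_measure mu0)
    (hf1 : Cb1 f1) (hf2 : Cb01 T f2)
    (heq : {ae mu0, forall w : path0 T d,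
      f1 (x + Num.sqrt eps *: w T) =
      \int[lebesgue_measure]_(s in `[0, T]) f2 s (x + Num.sqrt eps *: w s)}) :
  exists F : R -> R,
    C1_in `[0, T] F /\
    forall (t : R) (y : 'rV[R]_d), t \in `[0, T] ->
      f2 t y = derive_in `[0, T] F t /\ f1 y = F T.
Proof.
have [cf1 _ _] := hf1; have [cf2 [M f2M] _] := hf2.
have se0 : 0 < Num.sqrt eps by rewrite sqrtr_gt0.
have clT s := clamp_in (ltW hT) s.
(* The affine change of variables absorbs [x] and [eps]; as it is onto, constancy in the new
   variable gives constancy in the old one. *)
pose aff (y : 'rV[R]_d) := x + Num.sqrt eps *: y.
pose aff' (y : 'rV[R]_d) := (Num.sqrt eps)^-1 *: (y - x).
have affK y : aff (aff' y) = y.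
  by rewrite /aff /aff' scalerA divff ?gt_eqF// scale1r addrC subrK.
have caff : continuous aff.
  by move=> y; exact: (cvgD (@cst_continuous _ _ x y)
    (@scaler_continuous _ 'rV[R]_d (Num.sqrt eps) y)).
(* Freezing [f2] at its endpoint values outside [[0, T]] makes it jointly continuous and bounded for
   all times. *)
pose h2 s y := f2 (clamp T s) y.
have ch2 : continuous (fun p : R * 'rV[R]_d => h2 p.1 p.2).
  apply: (@continuous_within_comp _ _ _ _ (fun p : R * 'rV[R]_d => f2 p.1 p.2)
    (fun p : R * 'rV[R]_d => (clamp T p.1, p.2)) cf2).
    apply: continuous_pair => p; last exact: cvg_snd.
    by apply: continuous_comp; [exact: cvg_fst|exact: clamp_continuous].
  by move=> p; split => //=; exact: clT.
pose g1 y := f1 (aff y).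
pose g2 s y := h2 s (aff y).
have cg1 : continuous g1 by move=> y; apply: continuous_comp; [exact: caff|exact: cf1].
have cg2 : continuous (fun p : R * 'rV[R]_d => g2 p.1 p.2).
  move=> p; apply: (@continuous_comp _ _ _ (fun p : R * 'rV[R]_d => (p.1, aff p.2))
    (fun p => h2 p.1 p.2)).
    apply: continuous_pair => q; first exact: cvg_fst.
    by apply: continuous_comp; [exact: cvg_snd|exact: caff].
  exact: ch2.
have cslice y : continuous (fun s => h2 s y).
  move=> s; apply: (@continuous_comp _ _ _ (fun s => (s, y)) (fun p => h2 p.1 p.2)).
    by apply: continuous_pair => ?; [exact: cvg_id|exact: cst_continuous].
  exact: ch2.
have T_in : T \in `[0, T] by rewrite in_itv/= lexx ltW.
have g2M s y : `|g2 s y| <= M by exact: f2M.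
have intE (w : path0 T d) : \int[lebesgue_measure]_(s in `[0, T]) g2 s (w (clamp T s)) =
    \int[lebesgue_measure]_(s in `[0, T]) f2 s (x + Num.sqrt eps *: w s).
  by apply: eq_Rintegral => s; rewrite inE /= => sT; rewrite /g2 /h2 /= clamp_id.
have g12 : {ae mu0, forall w : path_space T d, g1 (((w : path0 T d) \o clamp T) T) =
    \int[lebesgue_measure]_(s in `[0, T]) g2 s (((w : path0 T d) \o clamp T) s)}.
  have heq' : {ae mu0, forall w : path_space T d, f1 (aff ((w : path0 T d) T)) =
      \int[lebesgue_measure]_(s in `[0, T]) f2 s (aff ((w : path0 T d) s))} by [].
  by apply: filterS heq' => w; rewrite /= intE clamp_id.
(* Invariance along every coordinate direction makes the drift constant in space; [aff 0] serves as
   reference point. *)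
have h2_open s y : 0 < s -> s < T -> h2 s y = h2 s (aff 0).
  move=> s0 sT; rewrite -[y]affK.
  apply: (@constant_of_delta_shift _ _ (g2 s)) => z r j.
  exact: (drift_shift hT hmu0 cg1 cg2 g2M g12).
(* The times 0 and [T], not covered by [drift_shift], follow by continuity in time. *)
have h2_const s y : s \in `[0, T] -> h2 s y = h2 s (aff 0).
  move=> sT; pose G s := h2 s y - h2 s (aff 0).
  have cG : continuous G by move=> t; exact: (cvgB (cslice y t) (cslice (aff 0) t)).
  have G0 t : 0 < t -> t < T -> G t = 0 by move=> *; rewrite /G h2_open// subrr.
  have nn n : n.+2%:R^-1 < 1 :> R by rewrite invf_lt1// ltr1n.
  have nn0 n : 0 < n.+2%:R^-1 :> R by rewrite invr_gt0.
  suff : G s = 0 by move/eqP; rewrite subr_eq0 => /eqP.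
  move: sT; rewrite in_itv/= => /andP[s0 sT].
  have [s0'|s0'] := ltP 0 s; last first.
    have -> : s = 0 by apply/eqP; rewrite eq_le s0 s0'.
    apply: (continuous_seq_eq0 cG (@cvg_shrink R 0 T)) => n.
    by apply: G0; rewrite add0r; [exact: mulr_gt0|rewrite gtr_pMr].
  have [sT'|Ts] := ltP s T; first exact: G0.
  have -> : s = T by apply/eqP; rewrite eq_le sT Ts.
  apply: (continuous_seq_eq0 cG (@cvg_shrink R T (- T))) => n.
  by apply: G0; rewrite mulNr ?subr_gt0 ?gtr_pMr// gtrBl mulr_gt0.
(* Since the drift is constant in space, its integral along any path is the number [c]; hence [f1]
   equals [c] almost surely at time [T], and everywhere by full support. *)
pose c := \int[lebesgue_measure]_(s in `[0, T]) h2 s (aff 0).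
have f1_const y : f1 y = c.
  apply/eqP; rewrite -subr_eq0 -[y]affK; apply/eqP.
  apply: (wiener_full_support (k := fun z => g1 z - c) hmu0 hT (lexx T)).
    by move=> z; exact: (cvgB (cg1 z) (cvg_cst _)).
  suff : {ae mu0, forall w : path_space T d, g1 ((w : path0 T d) T) - c = 0} by [].
  apply: filterS g12 => w; rewrite /= clamp_id// => ->.
  apply/eqP; rewrite subr_eq0; apply/eqP; apply: eq_Rintegral => s; rewrite inE /= => sT.
  exact: h2_const.
have [F [C1F dF FT]] := C1_antiderivative hT (cslice (aff 0)) c.
exists F; split => // t y tT; split; last by rewrite FT f1_const.
by rewrite dF// -(h2_const t y tT) /h2 clamp_id.
Qed.
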